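(* Let $\Phi$ be a $k$-body potential on $\mathbb{Z}^D$ (for a quantum spin system with local Hilbert space dimension $d$), with Hamiltonians $H_\Lambda$ and time-evolutions $\tau^\Lambda_t$. Assume that there exists a real-valued function $h(t,r)$, defined for $t\ge 0$ and distances $r\ge 0$, with $h(0,r)=0$ for $r>0$ and differentiable in $t$ (one-sidedly at $t=0$), such that for every finite subset $\Lambda\subset\mathbb{Z}^D$, any two points $x\neq y$ in $\Lambda$ and all $t\ge 0$, $$C^\Lambda_{x,y}(t):=\max_{A,B}\frac{\|[\tau^\Lambda_t(A),B]\|}{\|A\|\,\|B\|}\le h(t,|x-y|),$$ where the maximization is over nonzero single-site operators $A\in\mathcal{A}_{\{x\}}$ and $B\in\mathcal{A}_{\{y\}}$. Then there exists a constant $m_k$ depending only on $k$ and, for every finite $\Lambda\subset\mathbb{Z}^D$, a $k$-body potential $\hat\Phi_\Lambda$ on $\Lambda$ giving rise to the same time-evolution $\tau^\Lambda_t$, such that $$\|\hat\Phi_\Lambda(X)\|\le m_k\,\partial_t h\big(0,\mathrm{diam}(X)\big)\qquad\text{for all }X\subseteq\Lambda\text{ with }|X|\ge 2 .$$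
   Context: Each site $x\in\mathbb{Z}^D$ carries a $d$-dimensional Hilbert space $\mathcal{H}_x$ ($d$ finite). For finite $X\subset\mathbb{Z}^D$, $\mathcal{H}_X=\bigotimes_{x\in X}\mathcal{H}_x$ and $\mathcal{A}_X=\mathcal{B}(\mathcal{H}_X)$ (with $\mathcal{A}_\emptyset=\mathbb{C}\mathbb{1}$). If $Y\subseteq X$, $\mathcal{A}_Y$ is regarded as a subalgebra of $\mathcal{A}_X$ by tensoring with identities. $\|\cdot\|$ is the operator norm, $|x-y|$ is the graph distance on the lattice $\mathbb{Z}^D$, $\mathrm{diam}(X)=\sup_{x,y\in X}|x-y|$, and $|X|$ is the number of sites in $X$. A potential $\Phi$ associates to each finite $X\subset\mathbb{Z}^D$ an operator $\Phi(X)=\Phi(X)^\dagger\in\mathcal{A}_X$; a potential on $\Lambda$ is such an assignment for subsets $X\subseteq\Lambda$ only. It is $k$-body if $\Phi(X)=0$ whenever $|X|>k$ (no restriction on the range of interactions). For finite $\Lambda$, $H_\Lambda=\sum_{X\subseteq\Lambda}\Phi(X)$ and $\tau^\Lambda_t(A)=e^{iH_\Lambda t}Ae^{-iH_\Lambda t}$ for $A\in\mathcal{A}_\Lambda$. A potential $\hat\Phi_\Lambda$ on $\Lambda$ gives rise to the time-evolution $\tau^\Lambda_t$ if the Hamiltonian $\sum_{X\subseteq\Lambda}\hat\Phi_\Lambda(X)$ generates $\tau^\Lambda_t$ in this way. *)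

(* Defs.v *)
From HB Require Import structures.
From mathcomp Require Import all_boot all_order all_algebra.
From mathcomp Require Import finmap.
From mathcomp Require Import boolp classical_sets functions reals.
From mathcomp Require Import interval_inference topology normedtype sequences.
From mathcomp Require Import derive complex.

Set Implicit Arguments.
Unset Strict Implicit.
Unset Printing Implicit Defensive.

Import Order.TTheory GRing.Theory Num.Theory numFieldNormedType.Exports.
Import ComplexField.

Local Open Scope classical_set_scope.
Local Open Scope complex_scope.
Local Open Scope fset_scope.
Local Open Scope ring_scope.

Definition lattice_adj (D : nat) : rel 'rV[int]_D :=
  fun x y =>
    [exists i, (y == x + delta_mx 0 i) || (x == y + delta_mx 0 i)].

Definition lattice_walk (D : nat) (x y : 'rV[int]_D) (n : nat) : Prop :=
  exists p : seq 'rV[int]_D,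
    [/\ path (@lattice_adj D) x p, last x p = y & size p = n].

Lemma lattice_walk_cat (D : nat) (x y z : 'rV[int]_D) (n m : nat) :
  lattice_walk x y n -> lattice_walk y z m -> lattice_walk x z (n + m).
Proof.
move=> [p [pp lp <-]] [q [pq lq <-]]; exists (p ++ q).
by rewrite cat_path last_cat size_cat lp pp pq lq.
Qed.

Lemma lattice_walk_axis (D : nat) (x : 'rV[int]_D) (i : 'I_D) (a : int) :
  exists n, lattice_walk x (x + a *: delta_mx 0 i) n.
Proof.
elim: a => [|a [n wn]|a [n wn]].
- by exists 0%N, [::]; rewrite scale0r addr0.
- exists (n + 1)%N; apply: lattice_walk_cat wn _.
  exists [:: x + a.+1%:Z *: delta_mx 0 i]; split => //=.
  rewrite andbT; apply/existsP; exists i; apply/orP; left; apply/eqP.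
  by rewrite intS scalerDl scale1r -addrA [_ *: _ + _]addrC.
- exists (n + 1)%N; apply: lattice_walk_cat wn _.
  exists [:: x + (- a.+1%:Z) *: delta_mx 0 i]; split => //=.
  rewrite andbT; apply/existsP; exists i; apply/orP; right; apply/eqP.
  by rewrite intS opprD scalerDl scaleN1r -addrA addrAC addNr add0r.
Qed.

Lemma lattice_connected (D : nat) (x y : 'rV[int]_D) :
  exists n, `[< lattice_walk x y n >].
Proof.
suff [n wn] : exists n, lattice_walk x (x + \sum_(i < D) (y - x) 0 i *: delta_mx 0 i) n.
  by exists n; apply/asboolP; rewrite -row_sum_delta addrC subrK in wn.
elim/big_rec: _ => [|i v _ [n wn]]; first by exists 0%N, [::]; rewrite addr0.
have [m wm] := lattice_walk_axis (x + v) i ((y - x) 0 i).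
by exists (n + m)%N; rewrite addrCA addrC; apply: lattice_walk_cat wn wm.
Qed.

Definition graph_dist (D : nat) (x y : 'rV[int]_D) : nat :=
  ex_minn (lattice_connected x y).

Definition diam (D : nat) (X : {fset 'rV[int]_D}) : nat :=
  (\max_(x : X) \max_(y : X) graph_dist (val x) (val y))%N.

(* [{ffun X -> 'I_d}] labels the product basis of the tensor product over X of
   the spaces C^d, so an operator is its matrix in that basis. *)
Definition op (R : realType) (D d : nat) (X : {fset 'rV[int]_D}) : Type :=
  'M[R[i]]_#|{ffun X -> 'I_d}|.

(* A |-> A (x) 1 : with s = (u, w) split along Y and its complement in X, the
   matrix entry between (u, w) and (u', w') is A u u' if w = w', and 0 if not. *)
Definition embed (R : realType) (D d : nat) (Y X : {fset 'rV[int]_D})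
    (sYX : Y `<=` X) (A : op R d Y) : op R d X :=
  \matrix_(a, b)
    let s : {ffun X -> 'I_d} := enum_val a in
    let s' : {ffun X -> 'I_d} := enum_val b in
    if [forall x : X, (val x \notin Y) ==> (s x == s' x)]
    then A (enum_rank [ffun y : Y => s (fincl sYX y)])
           (enum_rank [ffun y : Y => s' (fincl sYX y)])
    else 0.

Definition l2norm (R : realType) (n : nat) (v : 'cV[R[i]]_n) : R :=
  Num.sqrt (\sum_(i < n) Normc.normc (v i 0) ^+ 2).

Definition opnorm (R : realType) (n : nat) (A : 'M[R[i]]_n) : R :=
  sup [set l2norm (A *m v) | v in [set v : 'cV[R[i]]_n | l2norm v = 1]].

Definition commutator (R : realType) (n : nat) (A B : 'M[R[i]]_n) :
    'M[R[i]]_n :=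
  A *m B - B *m A.

(* [R[i]^o] is [R[i]] carrying the topology of its norm. *)
Definition expmx (R : realType) (n : nat) (A : 'M[R[i]]_n) : 'M[R[i]]_n :=
  lim (series (fun j : nat => j`!%:R^-1 *: (A ^+ j : 'M[(R[i])^o]_n)) @ \oo).

Definition evolution (R : realType) (n : nat) (H : 'M[R[i]]_n) (t : R)
    (A : 'M[R[i]]_n) : 'M[R[i]]_n :=
  expmx (('i * t%:C) *: H) *m A *m expmx (- ('i * t%:C) *: H).

Record potential (R : realType) (D d : nat) := Potential {
  pot :> forall X : {fset 'rV[int]_D}, op R d X;
  _ : forall X, pot X \is hermsymmx }.

Record potential_on (R : realType) (D d : nat) (L : {fset 'rV[int]_D}) :=
  PotentialOn {
    pot_on :> forall X : fpowerset L, op R d (val X);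
    _ : forall X, pot_on X \is hermsymmx }.

Lemma restrict_herm (R : realType) (D d : nat) (P : potential R D d)
    (L : {fset 'rV[int]_D}) (X : fpowerset L) : P (val X) \is hermsymmx.
Proof. by case: P. Qed.

Definition restrict (R : realType) (D d : nat) (P : potential R D d)
    (L : {fset 'rV[int]_D}) : potential_on R d L :=
  PotentialOn (@restrict_herm R D d P L).

Definition kbody (R : realType) (D d k : nat) (P : potential R D d) : Prop :=
  forall X : {fset 'rV[int]_D}, (k < #|` X|)%N -> P X = 0.

Definition kbody_on (R : realType) (D d k : nat) (L : {fset 'rV[int]_D})
    (P : potential_on R d L) : Prop :=
  forall X : fpowerset L, (k < #|` val X|)%N -> P X = 0.

Lemma fpowerset_sub (D : nat) (L : {fset 'rV[int]_D}) (X : fpowerset L) :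
  val X `<=` L.
Proof. by rewrite -fpowersetE; exact: valP. Qed.

Lemma site_sub (D : nat) (L : {fset 'rV[int]_D}) (x : L) :
  [fset val x] `<=` L.
Proof. by rewrite fsub1set; exact: valP. Qed.

Definition hamiltonian (R : realType) (D d : nat) (L : {fset 'rV[int]_D})
    (P : potential_on R d L) : op R d L :=
  \sum_(X : fpowerset L) embed (fpowerset_sub X) (P X).

Definition same_evolution (R : realType) (D d : nat) (L : {fset 'rV[int]_D})
    (P Q : potential_on R d L) : Prop :=
  forall (t : R) (A : op R d L),
    evolution (hamiltonian P) t A = evolution (hamiltonian Q) t A.

(* The maximum over nonzero A, B; the set is nonempty as soon as 0 < d, and the
   ratios are bounded, so that the junk values of [sup] do not occur. *)
Definition lieb_robinson (R : realType) (D d : nat) (L : {fset 'rV[int]_D})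
    (P : potential_on R d L) (x y : L) (t : R) : R :=
  sup [set c | exists (A : op R d [fset val x]) (B : op R d [fset val y]),
    [/\ A != 0, B != 0 &
      c = opnorm (commutator (evolution (hamiltonian P) t (embed (site_sub x) A))
                             (embed (site_sub y) B))
          / (opnorm A * opnorm B)]].

Definition right_quotient (R : realType) (f : R -> R) (a : R) : R -> R :=
  fun u => u^-1 * (f (a + u) - f a).

Definition right_derivable (R : realType) (f : R -> R) (a : R) : Prop :=
  cvg (right_quotient f a u @[u --> 0^'+]).

Definition right_derive (R : realType) (f : R -> R) (a : R) : R :=
  lim (right_quotient f a u @[u --> 0^'+]).

(* Differentiability on [0, +oo); values of f at negative arguments are
   irrelevant. *)
Definition differentiable_from0 (R : realType) (f : R -> R) : Prop :=
  (forall t : R, 0 < t -> derivable f t 1) /\ right_derivable f 0.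

(* Main.v *)
(* Split H as the sum over X of its components H_X, traceless at every site of X
   and trivial at every other site.  The potential X |-> H_X generates the same
   dynamics and is k-body because a term of H supported on Y has no component
   at X unless X is contained in Y.  To bound H_X, choose x, y in X at distance
   diam X.  The normalized partial trace E_x at x is the average of U H U^* over
   the unitaries U of C^d that permute the basis cyclically and change signs, so
   that |(1 - E_y)(1 - E_x)H| <= sup_(U, V) |[[H, U], V]| with U at x and V at y,
   and i [[H, U], V] is the right derivative at 0 of [tau_t(U), V].
   The k - 2 remaining factors 1 - E_z have norm at most 2. *)
Require Import Defs.
From HB Require Import structures.
From mathcomp Require Import all_boot all_order all_algebra.
From mathcomp Require Import finmap.
From mathcomp Require Import boolp classical_sets functions reals.
From mathcomp Require Import interval_inference topology normedtype sequences.
From mathcomp Require Import complex.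
From mathcomp Require Import fintype finset.
From mathcomp Require Import ring lra.

Set Implicit Arguments.
Unset Strict Implicit.
Unset Printing Implicit Defensive.

(* [Defs] comes last because its [restrict] is shadowed by the one of [functions]. *)
Import Order.TTheory GRing.Theory Num.Theory numFieldNormedType.Exports.
Import ComplexField Normc Defs.

Local Open Scope fset_scope.
Local Open Scope ring_scope.

(** * Norms *)

(** The terms of [Phi] itself cannot be estimated: large terms may cancel in the Hamiltonian, and
    the hypothesis sees only the dynamics. This is why the new potential is read off from H alone.
    Operators at distinct sites commute at time 0, so the first-order term in t of their commutator
    is what h controls. The evolution is never differentiated: a second-order remainder bound for
    small t is divided by t. A finite family of unitaries replaces a Haar integral. Averaging over
    signs removes the entries that are off-diagonal at the site, and averaging over cyclic shifts
    equalizes the diagonal ones. These matrices are real, so transposition inverts them. A component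
    of H is a matrix on all of [L] and must be brought back to X without increasing its norm; a
    submatrix taken at a reference configuration outside X does this. The averages cost no constant,
    hence no dependence on d or D. One factor 2 is allowed for each site of X, including x and y,
    which gives m_k = 2^k. *)

Section ComplexNorm.
Variable R : realType.
Implicit Types z w : R[i].

Lemma normc_norm z : `|z| = (normc z)%:C%C.
Proof. by case: z. Qed.

Lemma normc_ge0 z : 0 <= normc z.
Proof. by case: z => a b; exact: sqrtr_ge0. Qed.

Lemma ler_normcD z w : normc (z + w) <= normc z + normc w.
Proof. by rewrite -lecR rmorphD /= -!normc_norm ler_normD. Qed.

Lemma normcN z : normc (- z) = normc z.
Proof. by case: z => a b /=; rewrite !sqrrN. Qed.

Lemma normc_real (x : R) : normc x%:C%C = `|x|.
Proof. by rewrite /= expr0n addr0 sqrtr_sqr. Qed.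

Lemma normc_nat m : normc (m%:R : R[i]) = m%:R.
Proof. by rewrite -(rmorph_nat (real_complex R)) normc_real normr_nat. Qed.

Lemma normc_Re z : `|complex.Re z| <= normc z.
Proof. by rewrite -lecR -normc_norm normc_ge_Re. Qed.

Lemma normc_Im z : `|complex.Im z| <= normc z.
Proof.
case: z => a b /=; rewrite -sqrtr_sqr ler_wsqrtr // lerDr sqr_ge0 //.
Qed.

Lemma normc_ReIm z : normc z <= `|complex.Re z| + `|complex.Im z|.
Proof.
case: z => a b /=; rewrite -[leRHS]ger0_norm ?addr_ge0 // -sqrtr_sqr.
rewrite ler_wsqrtr // sqrrD !real_normK ?num_real //.
by rewrite addrAC lerDl mulrn_wge0 // mulr_ge0.
Qed.

Lemma ler_normc_sum (I : Type) (r : seq I) (P : pred I) (F : I -> R[i]) :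
  normc (\sum_(i <- r | P i) F i) <= \sum_(i <- r | P i) normc (F i).
Proof.
elim/big_ind2: _ => [|z a w b za wb|//]; first by rewrite normc0.
exact: le_trans (ler_normcD _ _) (lerD za wb).
Qed.

End ComplexNorm.

Section EuclideanNorm.
Variables (R : realType) (n : nat).
Implicit Types v w : 'cV[R[i]]_n.

Lemma l2norm_ge0 v : 0 <= l2norm v.
Proof. exact: sqrtr_ge0. Qed.

Lemma l2norm_sqr v : l2norm v ^+ 2 = \sum_i normc (v i 0) ^+ 2.
Proof. by rewrite sqr_sqrtr // sumr_ge0 // => i _; exact: sqr_ge0. Qed.

Lemma normc_le_l2norm v i : normc (v i 0) <= l2norm v.
Proof.
rewrite -(ler_pXn2r (ltn0Sn 1)) ?nnegrE ?normc_ge0 ?l2norm_ge0 //.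
rewrite l2norm_sqr (bigD1 i) //= lerDl sumr_ge0 // => j _; exact: sqr_ge0.
Qed.

Lemma l2norm0 : l2norm (0 : 'cV[R[i]]_n) = 0.
Proof.
apply/eqP; rewrite -sqrf_eq0 l2norm_sqr big1 // => i _.
by rewrite mxE normc0 expr0n.
Qed.

Lemma l2norm_eq0 v : l2norm v = 0 -> v = 0.
Proof.
move=> v0; apply/matrixP => i j; rewrite ord1 mxE; apply: eq0_normc.
by apply/le_anti; rewrite normc_ge0 andbT -v0 normc_le_l2norm.
Qed.

Lemma l2normZ (a : R[i]) v : l2norm (a *: v) = normc a * l2norm v.
Proof.
apply/eqP; rewrite -(eqrXn2 (ltn0Sn 1)) ?mulr_ge0 ?l2norm_ge0 ?normc_ge0 //.
rewrite exprMn !l2norm_sqr mulr_sumr; apply/eqP/eq_bigr => i _.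
by rewrite mxE normcM exprMn.
Qed.

(** A weighted mean inequality takes the place of Cauchy-Schwarz: the weights are chosen so that the
    coordinatewise bounds add up to exactly (V + W)^2. They divide by both norms, so zero vectors
    are set apart. *)
Lemma l2normD v w : l2norm (v + w) <= l2norm v + l2norm w.
Proof.
have [/l2norm_eq0 -> |v0] := eqVneq (l2norm v) 0.
  by rewrite l2norm0 !add0r.
have [/l2norm_eq0 -> |w0] := eqVneq (l2norm w) 0.
  by rewrite l2norm0 !addr0.
have vp : 0 < l2norm v by rewrite lt_neqAle eq_sym v0 l2norm_ge0.
have wp : 0 < l2norm w by rewrite lt_neqAle eq_sym w0 l2norm_ge0.
rewrite -(ler_pXn2r (ltn0Sn 1)) ?nnegrE ?addr_ge0 ?l2norm_ge0 //.
set V := l2norm v in vp *; set W := l2norm w in wp *.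
(* |v_i + w_i|^2 <= (1 + W / V) |v_i|^2 + (1 + V / W) |w_i|^2 *)
have -> : (V + W) ^+ 2 = \sum_i ((1 + W / V) * normc (v i 0) ^+ 2 +
                                 (1 + V / W) * normc (w i 0) ^+ 2).
  rewrite big_split /= -!mulr_sumr -!l2norm_sqr -/V -/W.
  by field; rewrite v0 w0.
rewrite l2norm_sqr; apply: ler_sum => i _; rewrite mxE.
have := ler_normcD (v i 0) (w i 0); set a := normc (v i 0); set b := normc (w i 0).
move=> /(lerXn2r 2) -/(_ (normc_ge0 _)); rewrite nnegrE addr_ge0 ?normc_ge0 //.
move=> /(_ isT) /le_trans; apply.
rewrite -subr_ge0.
suff -> : (1 + W / V) * a ^+ 2 + (1 + V / W) * b ^+ 2 - (a + b) ^+ 2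
        = V * W * (a / V - b / W) ^+ 2.
  by rewrite mulr_ge0 ?sqr_ge0 // mulr_ge0 // ltW.
by field; rewrite v0 w0.
Qed.

Lemma l2norm_delta (i : 'I_n) : l2norm (delta_mx i 0 : 'cV[R[i]]_n) = 1.
Proof.
apply/eqP; rewrite -(eqrXn2 (ltn0Sn 1)) ?l2norm_ge0 // expr1n l2norm_sqr.
rewrite (bigD1 i) //= big1 => [|j ji].
  by rewrite mxE !eqxx normc1 expr1n addr0.
by rewrite mxE (negbTE ji) normc0 expr0n.
Qed.

End EuclideanNorm.

(* [opnorm] is sealed because unification otherwise unfolds its supremum when
   it compares norms of different matrices. *)
HB.lock Definition mxnorm (R : realType) (n : nat) (A : 'M[R[i]]_n) : R :=
  opnorm A.
Canonical mxnorm_unlockable := Unlockable mxnorm.unlock.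

Lemma mxnormE (R : realType) (n : nat) (A : 'M[R[i]]_n) : mxnorm A = opnorm A.
Proof. by rewrite unlock. Qed.

Section OperatorNorm.
Variables (R : realType) (n : nat).
Implicit Types (A B : 'M[R[i]]_n) (v : 'cV[R[i]]_n).

(** This makes the supremum in [opnorm] a genuine one. The crude bound by the sum of all entries is
    enough, since a unit vector has coordinates of modulus at most 1. *)
Lemma mxnorm_has_ubound A :
  has_ubound [set l2norm (A *m v) | v in [set v | l2norm v = 1]]%classic.
Proof.
exists (\sum_i \sum_j normc (A i j)) => _ [v v1 <-].
have AvE : A *m v = \sum_i (A *m v) i 0 *: delta_mx i 0.
  rewrite {1}[A *m v]matrix_sum_delta; apply: eq_bigr => i _.
  by rewrite big_ord1.
rewrite AvE; apply: (@le_trans _ _ (\sum_i normc ((A *m v) i 0))).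
  elim/big_ind2: _ => [|u a w b ua wb|i _]; first by rewrite l2norm0.
    exact: le_trans (l2normD _ _) (lerD ua wb).
  by rewrite l2normZ l2norm_delta mulr1.
apply: ler_sum => i _; rewrite mxE; apply: le_trans (ler_normc_sum _ _ _) _.
apply: ler_sum => j _; rewrite normcM ler_piMr ?normc_ge0 //.
by rewrite -v1 normc_le_l2norm.
Qed.

Lemma mxnorm_ge0 A : 0 <= mxnorm A.
Proof.
rewrite unlock /opnorm; set S := (X in sup X).
(* For n = 0 there is no unit vector, and [sup] of the empty set is 0. *)
have [/eqP ->|/set0P[r Sr]] := boolP (S == classical_sets.set0); first by rewrite sup0.
apply: le_trans (ub_le_sup (mxnorm_has_ubound A) Sr).
by case: Sr => v _ <-; exact: l2norm_ge0.
Qed.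

Lemma l2norm_mulmx A v : l2norm (A *m v) <= mxnorm A * l2norm v.
Proof.
have [/l2norm_eq0 ->|v0] := eqVneq (l2norm v) 0.
  by rewrite mulmx0 l2norm0 mulr0.
have vp : 0 < l2norm v by rewrite lt_neqAle eq_sym v0 l2norm_ge0.
rewrite -ler_pdivrMr // mulrC unlock.
have nV : normc ((l2norm v)^-1%:C%C) = (l2norm v)^-1.
  by rewrite normc_real ger0_norm // invr_ge0 ltW.
apply: (ub_le_sup (mxnorm_has_ubound A)).
exists ((l2norm v)^-1%:C%C *: v).
  by rewrite /= l2normZ nV mulVf.
by rewrite -scalemxAr l2normZ nV.
Qed.

Lemma mxnorm_le A (c : R) : 0 <= c ->
  (forall v, l2norm (A *m v) <= c * l2norm v) -> mxnorm A <= c.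
Proof.
move=> c0 Ac; rewrite unlock /opnorm; set S := (X in sup X).
have [/eqP ->|/set0P S0] := boolP (S == classical_sets.set0); first by rewrite sup0.
apply: ge_sup => // _ [v v1 <-].
by apply: le_trans (Ac v) _; rewrite v1 mulr1.
Qed.

Lemma mxnorm0 : mxnorm (0 : 'M[R[i]]_n) = 0.
Proof.
apply/le_anti; rewrite mxnorm_ge0 andbT; apply: mxnorm_le => // v.
by rewrite mul0mx l2norm0 mul0r.
Qed.

Lemma mxnormD A B : mxnorm (A + B) <= mxnorm A + mxnorm B.
Proof.
apply: mxnorm_le => [|v]; first by rewrite addr_ge0 ?mxnorm_ge0.
rewrite mulmxDl mulrDl; apply: le_trans (l2normD _ _) _.
by apply: lerD; exact: l2norm_mulmx.
Qed.

Lemma mxnorm_sum (I : Type) (r : seq I) (P : pred I) (F : I -> 'M[R[i]]_n) :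
  mxnorm (\sum_(i <- r | P i) F i) <= \sum_(i <- r | P i) mxnorm (F i).
Proof.
elim/big_ind2: _ => [|A a B b Aa Bb|//]; first by rewrite mxnorm0.
exact: le_trans (mxnormD _ _) (lerD Aa Bb).
Qed.

Lemma mxnormZ_le (a : R[i]) A : mxnorm (a *: A) <= normc a * mxnorm A.
Proof.
apply: mxnorm_le => [|v]; first by rewrite mulr_ge0 ?normc_ge0 ?mxnorm_ge0.
rewrite -scalemxAl l2normZ -mulrA ler_wpM2l ?normc_ge0 //.
exact: l2norm_mulmx.
Qed.

Lemma mxnormZ (a : R[i]) A : mxnorm (a *: A) = normc a * mxnorm A.
Proof.
have [->|a0] := eqVneq a 0; first by rewrite scale0r mxnorm0 normc0 mul0r.
apply/le_anti; rewrite mxnormZ_le /=.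
have na : 0 < normc a.
  by rewrite lt_neqAle normc_ge0 andbT eq_sym; apply: contra_neq a0 => /eq0_normc.
rewrite -ler_pdivlMl // -normcV -{1}[A]scale1r -(mulVf a0) -scalerA.
exact: mxnormZ_le.
Qed.

Lemma mxnormN A : mxnorm (- A) = mxnorm A.
Proof. by rewrite -scaleN1r mxnormZ normcN normc1 mul1r. Qed.

Lemma mxnormB A B : mxnorm (A - B) <= mxnorm A + mxnorm B.
Proof. by rewrite -[mxnorm B]mxnormN mxnormD. Qed.

Lemma mxnormM A B : mxnorm (A *m B) <= mxnorm A * mxnorm B.
Proof.
apply: mxnorm_le => [|v]; first by rewrite mulr_ge0 ?mxnorm_ge0.
rewrite -mulmxA -mulrA; apply: le_trans (l2norm_mulmx _ _) _.
by rewrite ler_wpM2l ?mxnorm_ge0 // l2norm_mulmx.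
Qed.

(** Only an inequality, because the norm is 0 in dimension 0. *)
Lemma mxnorm1 : mxnorm (1%:M : 'M[R[i]]_n) <= 1.
Proof. by apply: mxnorm_le => // v; rewrite mul1mx mul1r. Qed.

Lemma mxnormX A j : mxnorm (A ^+ j) <= mxnorm A ^+ j.
Proof.
elim: j => [|j IH]; first exact: mxnorm1.
rewrite !exprS; apply: le_trans (mxnormM _ _) _.
by rewrite ler_wpM2l ?mxnorm_ge0.
Qed.

Lemma mxnorm_commutator A B :
  mxnorm (commutator A B) <= mxnorm A * mxnorm B *+ 2.
Proof.
apply: le_trans (mxnormB _ _) _; rewrite mulr2n lerD ?mxnormM //.
by rewrite mulrC mxnormM.
Qed.

Lemma normc_le_mxnorm A i j : normc (A i j) <= mxnorm A.
Proof.
have := l2norm_mulmx A (delta_mx j 0); rewrite l2norm_delta mulr1 -colE.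
by apply: le_trans; have := normc_le_l2norm (col j A) i; rewrite mxE.
Qed.

Lemma mxnorm_le_sum A : mxnorm A <= \sum_i \sum_j normc (A i j).
Proof.
apply: mxnorm_le => [|v].
  by do 2!(apply: sumr_ge0 => ? _); exact: normc_ge0.
rewrite {1}[A]matrix_sum_delta mulmx_suml.
have dle i j : mxnorm (delta_mx i j : 'M[R[i]]_n) <= 1.
  apply: mxnorm_le => // w; rewrite mul1r -(mul_delta_mx (0 : 'I_1)) -mulmxA.
  have -> : delta_mx 0 j *m w = (w j 0)%:M.
    by rewrite -rowE; apply/matrixP => a b; rewrite !ord1 !mxE eqxx.
  by rewrite mul_mx_scalar l2normZ l2norm_delta mulr1 normc_le_l2norm.
rewrite -mulmx_suml; apply: le_trans (l2norm_mulmx _ _) _.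
rewrite ler_wpM2r ?l2norm_ge0 //; apply: le_trans (mxnorm_sum _ _ _) _.
apply: ler_sum => i _; apply: le_trans (mxnorm_sum _ _ _) _.
apply: ler_sum => j _; rewrite mxnormZ ler_piMr ?normc_ge0 //.
Qed.

End OperatorNorm.

Lemma sum_codom (V : nmodType) (I J : finType) (f : J -> I) (F : I -> V) :
  injective f -> \sum_(i in codom f) F i = \sum_j F (f j).
Proof.
move=> fI; rewrite -big_uniq; last by rewrite codomE map_inj_uniq ?enum_uniq.
by rewrite codomE big_map big_enum.
Qed.

Lemma l2norm_mxsub_le (R : realType) (n m : nat) (f : 'I_m -> 'I_n)
    (v : 'cV[R[i]]_n) : injective f -> l2norm (rowsub f v) <= l2norm v.
Proof.
move=> fI; rewrite -(ler_pXn2r (ltn0Sn 1)) ?nnegrE ?l2norm_ge0 // !l2norm_sqr.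
rewrite [leRHS](bigID [in codom f]) /= -[leLHS]addr0 lerD //; last first.
  by apply: sumr_ge0 => i _; exact: sqr_ge0.
rewrite sum_codom //.
by apply: ler_sum => i _; rewrite mxE.
Qed.

(** The submatrix is J^* A J, where J is the isometry that extends a vector by zero outside the
    image of [f]; [v'] below is J v. *)
Lemma mxnorm_mxsub_le (R : realType) (n m : nat) (f : 'I_m -> 'I_n)
    (A : 'M[R[i]]_n) : injective f -> mxnorm (mxsub f f A) <= mxnorm A.
Proof.
move=> fI; apply: mxnorm_le => [|v]; first exact: mxnorm_ge0.
pose v' : 'cV[R[i]]_n := \sum_j v j 0 *: delta_mx (f j) 0.
have v'f j : v' (f j) 0 = v j 0.
  rewrite summxE (bigD1 j) //= big1 ?addr0 => [|l lj]; rewrite !mxE ?eqxx ?mulr1 //.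
  by rewrite (inj_eq fI) eq_sym (negbTE lj) mulr0.
have v'0 i : i \notin codom f -> v' i 0 = 0.
  move=> /codomP fi; rewrite summxE big1 // => j _; rewrite !mxE.
  by case: eqP => [ifj|_]; [case: fi; exists j | rewrite mulr0].
have v'n : l2norm v' = l2norm v.
  apply/eqP; rewrite -(eqrXn2 (ltn0Sn 1)) ?l2norm_ge0 // !l2norm_sqr.
  rewrite (bigID [in codom f]) /= addrC big1 ?add0r => [|i /v'0 ->]; last first.
    by rewrite normc0 expr0n.
  rewrite sum_codom //.
  by apply/eqP/eq_bigr => j _; rewrite v'f.
have -> : mxsub f f A *m v = rowsub f (A *m v').
  apply/matrixP => i j; rewrite ord1 !mxE [RHS](bigID [in codom f]) /=.
  rewrite [X in _ = _ + X]big1 ?addr0 => [|l /v'0 ->]; last by rewrite mulr0.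
  rewrite sum_codom //.
  by apply: eq_bigr => l _; rewrite !mxE v'f.
rewrite -v'n; apply: le_trans (l2norm_mxsub_le _ fI) _; exact: l2norm_mulmx.
Qed.

(** * The matrix exponential *)

Lemma cvg_sum0 (R : realType) (I : finType) (f : I -> nat -> R) :
  (forall i, (f i @ \oo --> (0 : R))%classic) ->
  ((fun m => \sum_i f i m) @ \oo --> (0 : R))%classic.
Proof.
move=> f0; elim: (index_enum I) => [|i r IH].
  rewrite (_ : (fun m => _) = (fun=> 0)); first exact: cvg_cst.
  by apply/funext => m; rewrite big_nil.
rewrite (_ : (fun m => _) = (fun m => f i m + \sum_(j <- r) f j m)).
  by have := cvgD (f0 i) IH; rewrite addr0; exact.
by apply/funext => m; rewrite big_cons.
Qed.

Section MatrixExponential.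
Variables (R : realType) (n : nat).
Implicit Types A : 'M[R[i]]_n.

Lemma cvg_mx_mxnorm (E : 'M[R[i]]_n) (S : nat -> 'M[R[i]]_n) :
  ((fun m => mxnorm (E - S m)) @ \oo --> (0 : R))%classic ->
  ((S : nat -> 'M[(R[i])^o]_n) @ \oo --> (E : 'M[(R[i])^o]_n))%classic.
Proof.
move=> /cvgrPdist_lt ES; apply/cvg_ballP => e e0.
(* The radius is a positive element of [R[i]]; such an element has zero imaginary part. *)
have eE : e = (complex.Re e)%:C%C by case: e e0 => a b; rewrite ltcE /= => /andP[/eqP ->].
have : 0 < complex.Re e by move: e0; rewrite {1}eE ltcR.
move=> /ES; apply: filterS => m; rewrite sub0r normrN ger0_norm ?mxnorm_ge0 //.
move=> ESm; split=> // i j; rewrite /ball /= normc_norm eE ltcR.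
by have := normc_le_mxnorm (E - S m) i j; rewrite !mxE => /le_lt_trans; apply.
Qed.

Lemma lim_mx_mxnorm (E : 'M[R[i]]_n) (S : nat -> 'M[R[i]]_n) :
  ((fun m => mxnorm (E - S m)) @ \oo --> (0 : R))%classic ->
  lim ((S : nat -> 'M[(R[i])^o]_n) @ \oo)%classic = (E : 'M[(R[i])^o]_n).
Proof.
by move=> /cvg_mx_mxnorm cE; apply: (cvg_lim _ cE); exact: norm_hausdorff.
Qed.

(** Completeness is borrowed from the reals: the real and imaginary parts of each entry are series
    dominated by [b], and finitely many entries control the norm. *)
Lemma mxnorm_complete (u : nat -> 'M[R[i]]_n) (b : nat -> R) :
  (forall j, mxnorm (u j) <= b j) -> cvgn (series b) ->
  exists E : 'M[R[i]]_n,
    ((fun m => mxnorm (E - \sum_(0 <= j < m) u j)) @ \oo --> (0 : R))%classic.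
Proof.
move=> ub cb.
have cvg_coord (v : nat -> R) : (forall j, `|v j| <= b j) -> cvgn (series v).
  move=> vb; apply: normed_cvg; apply: series_le_cvg vb cb => // j.
  by apply: le_trans (ub j); exact: mxnorm_ge0.
have cRe i k : cvgn (series (fun j => complex.Re (u j i k))).
  apply: cvg_coord => j; rewrite (le_trans (normc_Re _)) // (le_trans _ (ub j)) //.
  exact: normc_le_mxnorm.
have cIm i k : cvgn (series (fun j => complex.Im (u j i k))).
  apply: cvg_coord => j; rewrite (le_trans (normc_Im _)) // (le_trans _ (ub j)) //.
  exact: normc_le_mxnorm.
pose E : 'M[R[i]]_n := \matrix_(i, k)
  (limn (series (fun j => complex.Re (u j i k))) +i*
   limn (series (fun j => complex.Im (u j i k))))%C.
exists E.
pose g (m : nat) : R := \sum_i \sum_k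
  (`|limn (series (fun j => complex.Re (u j i k))) -
     series (fun j => complex.Re (u j i k)) m| +
   `|limn (series (fun j => complex.Im (u j i k))) -
     series (fun j => complex.Im (u j i k)) m|).
have dist0 (v : nat -> R) : cvgn v -> ((fun m => `|limn v - v m|) @ \oo --> (0 : R))%classic.
  move=> cv; rewrite -(normr0 R) -(subrr (limn v)).
  by apply: cvg_norm; apply: cvgB cv; exact: cvg_cst.
have g0 : (g @ \oo --> (0 : R))%classic.
  apply: cvg_sum0 => i; apply: cvg_sum0 => k; rewrite -[0 : R](addr0 0).
  by apply: cvgD; exact: dist0.
apply: squeeze_cvgr (cvg_cst 0) g0; apply: nearW => m.
rewrite mxnorm_ge0 /=; apply: le_trans (mxnorm_le_sum _) _.
apply: ler_sum => i _; apply: ler_sum => k _.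
apply: le_trans (normc_ReIm _) _; rewrite !mxE summxE !raddfB /= !raddf_sum /=.
by rewrite /series.
Qed.

Lemma leq_expn2_fact j : (2 ^ j <= j.+1`!)%N.
Proof.
elim: j => // j IH; rewrite expnS factS; exact: leq_mul.
Qed.

(** The leading 2 of the geometric series absorbs an index shift: 1 / (j+1)! <= 2^-j = 2 *
    2^-(j+1). *)
Lemma exp_term_le A j : mxnorm A <= 1 ->
  mxnorm (j`!%:R^-1 *: A ^+ j) <= geometric 2 (2^-1) j.
Proof.
move=> A1; rewrite mxnormZ normcV normc_nat.
apply: (@le_trans _ _ (j`!%:R^-1)).
  rewrite ler_piMr ?invr_ge0 // (le_trans (mxnormX _ _)) //.
  by rewrite exprn_ile1 // mxnorm_ge0.
case: j => [|j] /=; first by rewrite fact0 invr1 expr0 mulr1 ler1n.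
rewrite exprS mulrA divff ?pnatr_eq0 // mul1r exprVn lef_pV2 ?posrE ?exprn_gt0 //.
by rewrite -natrX ler_nat leq_expn2_fact.
Qed.

Lemma expmx_cvg A : mxnorm A <= 1 ->
  ((fun m => mxnorm (expmx A - \sum_(0 <= j < m) j`!%:R^-1 *: A ^+ j)) @ \oo
     --> (0 : R))%classic.
Proof.
move=> A1.
have [|E cE] := mxnorm_complete (fun j => exp_term_le j A1).
  by apply: is_cvg_geometric_series; rewrite gtr0_norm ?invf_lt1 ?ltr1n.
suff -> : expmx A = E by [].
exact: lim_mx_mxnorm cE.
Qed.

(** From order 2 on, the terms are at most |A|^2 / 2^j because 1 / (j+2)! <= 2^-j, and the geometric
    series sums to 2. The bound holds for all partial sums and passes to the limit. *)
Lemma expmx_approx A : mxnorm A <= 1 ->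
  mxnorm (expmx A - 1%:M - A) <= mxnorm A ^+ 2 *+ 2.
Proof.
move=> A1; set a := mxnorm A.
have tail m : mxnorm (\sum_(0 <= j < m) j.+2`!%:R^-1 *: A ^+ j.+2) <= a ^+ 2 *+ 2.
  apply: le_trans (mxnorm_sum _ _ _) _.
  have -> : a ^+ 2 *+ 2 = a ^+ 2 * 2 by rewrite mulr_natr.
  apply: (@le_trans _ _ (a ^+ 2 * \sum_(0 <= j < m) 2^-1 ^+ j)).
    rewrite mulr_sumr; apply: ler_sum => j _.
    rewrite mxnormZ normcV normc_nat.
    apply: (@le_trans _ _ (2^-1 ^+ j * a ^+ 2)); last by rewrite mulrC.
    apply: ler_pM; rewrite ?invr_ge0 ?mxnorm_ge0 ?ler0n //.
      rewrite exprVn lef_pV2 ?posrE ?exprn_gt0 ?ltr0n ?fact_gt0 //.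
      by rewrite -natrX ler_nat (leq_trans _ (leq_expn2_fact _)) // leq_exp2l.
    apply: le_trans (mxnormX _ _) _; rewrite -addn2 exprD ler_piMl ?sqr_ge0 //.
    by rewrite exprn_ile1 // mxnorm_ge0.
  rewrite ler_wpM2l ?sqr_ge0 // big_mkord.
  (* The identity p - 1 = (1/2 - 1) s for p = 2^-m gives s = 2 (1 - p) <= 2. *)
  have := subrX1 (2^-1 : R) m; move: (\sum_(i < m) _) => s.
  have : 0 <= 2^-1 ^+ m :> R by rewrite exprn_ge0.
  by move: (2^-1 ^+ m) => p; lra.
have c0 := expmx_cvg A1; rewrite -(cvg_shiftn 2) in c0.
have bound m : mxnorm (expmx A - 1%:M - A) <=
    mxnorm (expmx A - \sum_(0 <= j < m + 2) j`!%:R^-1 *: A ^+ j) + a ^+ 2 *+ 2.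
  rewrite addn2 !big_nat_recl //= -/(1%:M) fact0 invr1 scale1r expr1 expr0.
  apply: le_trans (lerD (lexx _) (tail m)); apply: le_trans (mxnormD _ _).
  by rewrite scale1r !opprD !addrA subrK.
rewrite -[leRHS]add0r.
by apply: cvgr_to_ge (cvgD c0 (cvg_cst _)) _; apply: nearW => m; exact: bound.
Qed.

End MatrixExponential.

(** * Short-time expansion of the Heisenberg evolution and the double commutator *)

Section HeisenbergEvolution.
Variables (R : realType) (n : nat).
Implicit Types H A B : 'M[R[i]]_n.

Lemma normc_i_real (t : R) : 0 <= t -> normc ('i * t%:C)%C = t.
Proof.
by move=> t0; rewrite normcM normc_real ger0_norm //= expr0n expr1n add0r sqrtr1 mul1r.
Qed.

Lemma expmx_first_order A : mxnorm A <= 1 ->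
  exists2 r, expmx A = 1%:M + A + r & mxnorm r <= mxnorm A ^+ 2 *+ 2.
Proof.
move=> A1; exists (expmx A - 1%:M - A); last exact: expmx_approx.
by rewrite -[expmx A - _ - _]addrA -opprD subrKC.
Qed.

(** Both exponentials are expanded to first order with remainders of norm at most 2 |X|^2. Besides A
    + [X, A] there remain [r1] A [e], (1 + X) A [r2] and X A X, which contribute 8, 4 and 1 to the
    constant 13. *)
Lemma conj_expmx_approx (X A : 'M[R[i]]_n) : mxnorm X <= 1 ->
  mxnorm (expmx X *m A *m expmx (- X) - A - commutator X A)
    <= 13 * mxnorm A * mxnorm X ^+ 2.
Proof.
move=> X1; have [r1 -> r1x] := expmx_first_order X1.
have [|r2 -> r2x] := @expmx_first_order (- X); first by rewrite mxnormN.
rewrite mxnormN in r2x.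
set e := 1%:M - X + r2.
have X0 := mxnorm_ge0 X; have A0 := mxnorm_ge0 A.
have X2 : mxnorm X ^+ 2 <= 1 := exprn_ile1 2 X0 X1.
have e4 : mxnorm e <= 4.
  apply: le_trans (mxnormD _ _) _; have := mxnormB 1%:M X.
  have := @mxnorm1 R n; lra.
have X12 : mxnorm (1%:M + X) <= 2.
  by have := mxnormD 1%:M X; have := @mxnorm1 R n; lra.
have -> : (1%:M + X + r1) *m A *m e - A - commutator X A =
    r1 *m A *m e + (1%:M + X) *m A *m r2 - X *m A *m X.
  rewrite mulmxDl mulmxDl {1}/e [_ *m (_ + r2)]mulmxDr.
  have -> : (1%:M + X) *m A *m (1%:M - X) = A + commutator X A - X *m A *m X.
    by rewrite mulmxBr mulmx1 mulmxDl mul1mx mulmxDl opprD !addrA [A + _ - _]addrAC.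
  move: (X *m A *m X) (_ *m A *m r2) (r1 *m A *m e) (commutator X A) => p q s c.
  by apply/matrixP => i j; rewrite !mxE; ring.
set x := mxnorm X in X0 X1 X2 r1x r2x *; set y := mxnorm A in A0 *.
have h1 : mxnorm (r1 *m A *m e) <= 8 * y * x ^+ 2.
  apply: le_trans (mxnormM _ _) _.
  apply: (@le_trans _ _ ((x ^+ 2 *+ 2 * y) * 4)).
    apply: ler_pM; rewrite ?mxnorm_ge0 //; apply: le_trans (mxnormM _ _) _.
    by rewrite ler_wpM2r.
  by rewrite -subr_ge0 (_ : _ - _ = 0) //; ring.
have h2 : mxnorm ((1%:M + X) *m A *m r2) <= 4 * y * x ^+ 2.
  apply: le_trans (mxnormM _ _) _.
  apply: (@le_trans _ _ ((2 * y) * (x ^+ 2 *+ 2))).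
    apply: ler_pM; rewrite ?mxnorm_ge0 //; apply: le_trans (mxnormM _ _) _.
    by rewrite ler_wpM2r.
  by rewrite -subr_ge0 (_ : _ - _ = 0) //; ring.
have h3 : mxnorm (X *m A *m X) <= y * x ^+ 2.
  apply: le_trans (mxnormM _ _) _; rewrite expr2 mulrA ler_wpM2r //.
  by apply: le_trans (mxnormM _ _) _; rewrite mulrC.
have := mxnormD (r1 *m A *m e) ((1%:M + X) *m A *m r2).
have := mxnormB (r1 *m A *m e + (1%:M + X) *m A *m r2) (X *m A *m X).
by lra.
Qed.

Lemma commutatorDl A A' B :
  commutator (A + A') B = commutator A B + commutator A' B.
Proof. by rewrite /commutator mulmxDl mulmxDr addrACA opprD. Qed.

Lemma commutatorZl (c : R[i]) A B : commutator (c *: A) B = c *: commutator A B.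
Proof. by rewrite /commutator -scalemxAl -scalemxAr scalerBr. Qed.

(** Since [A, B] = 0, the commutator [tau_t(A), B] equals i t [[H, A], B] up to O(t^2). Dividing by
    t, and using g(0) = 0, bounds the double commutator by the right difference quotient of g plus a
    multiple of t; then t tends to 0 from the right. *)
Lemma commutator_right_derive_le H A B (g : R -> R) :
  commutator A B = 0 -> g 0 = 0 -> right_derivable g 0 ->
  (forall t, 0 <= t -> mxnorm (commutator (evolution H t A) B) <= g t) ->
  mxnorm (commutator (commutator H A) B) <= right_derive g 0.
Proof.
move=> AB0 g0 dg gle; set K := mxnorm _.
(* Twice the 13 of [conj_expmx_approx], the commutator with [B] costing the factor 2. *)
pose C := 26 * mxnorm A * mxnorm B * mxnorm H ^+ 2.
have quot t : 0 < t -> t * mxnorm H <= 1 ->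
    K <= right_quotient g 0 t + C * t.
  move=> t0 tH; have t0' := ltW t0.
  pose z := ('i * t%:C)%C : R[i]; pose X := z *: H.
  have nX : mxnorm X = t * mxnorm H by rewrite mxnormZ normc_i_real.
  have := conj_expmx_approx A (X := X); rewrite nX => /(_ tH).
  have -> : expmx X *m A *m expmx (- X) = evolution H t A.
    by rewrite /evolution scaleNr.
  set r := evolution H t A - A - commutator X A => rle.
  have cE : z *: commutator (commutator H A) B =
            commutator (evolution H t A) B - commutator r B.
    have -> : evolution H t A = A + commutator X A + r.
      by rewrite /r -[_ - A - _]addrA -opprD subrKC.
    rewrite (commutatorDl (A + commutator X A)) (commutatorDl A) AB0 add0r addrK.
    by rewrite -commutatorZl -commutatorZl.
  have : t * K <= g t + C * t * t.
    rewrite -[X in X * K](normc_i_real t0') -mxnormZ cE.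
    apply: le_trans (mxnormB _ _) _; apply: lerD; first exact: gle.
    apply: le_trans (mxnorm_commutator _ _) _.
    apply: (@le_trans _ _ ((13 * mxnorm A * (t * mxnorm H) ^+ 2) * mxnorm B *+ 2)).
      by rewrite lerMn2r /= ler_wpM2r ?mxnorm_ge0.
    by rewrite -subr_ge0 (_ : _ - _ = 0) // /C; ring.
  rewrite -ler_pdivlMl // mulrDr [_^-1 * (_ * t)]mulrC mulfK ?lt0r_neq0 //.
  by rewrite /right_quotient add0r g0 subr0.
have cC : ((fun u : R => C * u) @ 0^'+ --> (0 : R))%classic.
  rewrite -[X in (_ --> X)%classic](mulr0 C); apply: cvg_at_right_filter.
  by apply: cvgM; [exact: cvg_cst | exact: cvg_id].
rewrite -[right_derive g 0]addr0.
apply: cvgr_to_ge (cvgD dg cC) _.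
(* The remainder bound requires t |H| <= 1. The threshold 1 / (1 + |H|) ensures this and is defined
   even when H = 0. *)
have H1 : 0 < 1 + mxnorm H by rewrite ltr_pwDl // mxnorm_ge0.
near=> t.
have t0 : 0 < t by near: t; exact: nbhs_right_gt.
apply: quot => //; apply: (@le_trans _ _ (t * (1 + mxnorm H))).
  by rewrite ler_wpM2l ?(ltW t0) // lerDr.
rewrite -ler_pdivlMr // mul1r ltW //.
by near: t; apply: nbhs_right_lt; rewrite invr_gt0.
Unshelve. all: by end_near.
Qed.

End HeisenbergEvolution.

(** * Signed permutation matrices and partial traces *)

Section MatrixEntries.
Variables (R : realType) (S : finType).
Implicit Types (M N : 'M[R[i]]_#|S|) (s : S).

(** Entries are addressed by basis labels, which keeps the enumeration of the basis out of the later
    computations. *)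
Definition entry M s s' : R[i] := M (enum_rank s) (enum_rank s').

Definition mx_of (F : S -> S -> R[i]) : 'M[R[i]]_#|S| :=
  \matrix_(a, b) F (enum_val a) (enum_val b).

Lemma entry_mx_of F s s' : entry (mx_of F) s s' = F s s'.
Proof. by rewrite /entry mxE !enum_rankK. Qed.

Lemma entryP M N : (forall s s', entry M s s' = entry N s s') -> M = N.
Proof.
move=> MN; apply/matrixP => a b; have := MN (enum_val a) (enum_val b).
by rewrite /entry !enum_valK.
Qed.

Lemma entryM M N s s' :
  entry (M *m N) s s' = \sum_r entry M s r * entry N r s'.
Proof.
rewrite /entry mxE (reindex_onto enum_rank enum_val) => [|a _]; last by rewrite enum_valK.
by apply: eq_bigl => r; rewrite enum_rankK eqxx.
Qed.

Lemma entryD M N s s' : entry (M + N) s s' = entry M s s' + entry N s s'.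
Proof. by rewrite /entry mxE. Qed.

Lemma entryN M s s' : entry (- M) s s' = - entry M s s'.
Proof. by rewrite /entry mxE. Qed.

Lemma entry_tr M s s' : entry M^T s s' = entry M s' s.
Proof. by rewrite /entry mxE. Qed.

Lemma entryZ a M s s' : entry (a *: M) s s' = a * entry M s s'.
Proof. by rewrite /entry mxE. Qed.

Lemma entry1 s s' : entry 1%:M s s' = (s == s')%:R.
Proof. by rewrite /entry mxE (inj_eq enum_rank_inj). Qed.

Lemma entry0 s s' : entry 0 s s' = 0.
Proof. by rewrite /entry mxE. Qed.

Lemma entry_sum (I : Type) (r : seq I) (P : pred I) (F : I -> 'M[R[i]]_#|S|) s s' :
  entry (\sum_(j <- r | P j) F j) s s' = \sum_(j <- r | P j) entry (F j) s s'.
Proof. by rewrite /entry summxE. Qed.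

(** This sends v to s |-> (-1)^(sg s) v(f s). For injective [f] it is a real orthogonal matrix, so
    its transpose is also its adjoint. *)
Definition sgperm_mx (f : S -> S) (sg : S -> bool) : 'M[R[i]]_#|S| :=
  mx_of (fun s s' => (-1) ^+ sg s *+ (s' == f s)).

Lemma entry_sgperm_mull f sg M s s' :
  entry (sgperm_mx f sg *m M) s s' = (-1) ^+ sg s * entry M (f s) s'.
Proof.
rewrite entryM (bigD1 (f s)) //= entry_mx_of eqxx big1 ?addr0 // => r.
by rewrite entry_mx_of => /negbTE ->; rewrite mul0r.
Qed.

Lemma entry_sgperm_mulr_tr f sg M s s' :
  entry (M *m (sgperm_mx f sg)^T) s s' = (-1) ^+ sg s' * entry M s (f s').
Proof.
rewrite entryM (bigD1 (f s')) //= entry_tr entry_mx_of eqxx big1 => [|r].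
  by rewrite addr0 mulrC.
by rewrite entry_tr entry_mx_of => /negbTE ->; rewrite mulr0.
Qed.

Section Injective.
Variables (f : S -> S) (sg : S -> bool) (f_inj : injective f).
Local Notation W := (sgperm_mx f sg).

Lemma sgperm_mulV : W *m W^T = 1%:M.
Proof.
apply: entryP => s s'; rewrite entry_sgperm_mulr_tr entry_mx_of entry1 (inj_eq f_inj) eq_sym.
by case: eqP => [->|_]; rewrite ?mulr0 // -signr_addb addbb.
Qed.

Lemma sgperm_mulVl : W^T *m W = 1%:M.
Proof. exact: mulmx1C sgperm_mulV. Qed.

Lemma l2norm_sgperm (v : 'cV[R[i]]_#|S|) : l2norm (W *m v) = l2norm v.
Proof.
apply/eqP; rewrite -(eqrXn2 (ltn0Sn 1)) ?l2norm_ge0 // !l2norm_sqr.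
have fI : injective (fun a : 'I_#|S| => enum_rank (f (enum_val a))).
  by move=> a b /enum_rank_inj /f_inj /enum_val_inj.
rewrite [eqbRHS](reindex_inj fI); apply/eqP/eq_bigr => a _; congr (_ ^+ 2).
rewrite mxE (bigD1 (enum_rank (f (enum_val a)))) //= mxE enum_rankK eqxx.
rewrite big1 => [|b]; last first.
  rewrite mxE -(inj_eq enum_val_inj) enum_rankK => /negbTE ->.
  by rewrite mul0r.
rewrite addr0 normcM; case: (sg _); rewrite ?normcN normc1 mul1r //.
Qed.

Lemma mxnorm_sgperm : (0 < #|S|)%N -> mxnorm W = 1.
Proof.
move=> S0; apply/le_anti/andP; split.
  by apply: mxnorm_le => // v; rewrite l2norm_sgperm mul1r.
have := l2norm_mulmx W (delta_mx (Ordinal S0) 0).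
by rewrite l2norm_sgperm l2norm_delta mulr1.
Qed.

Lemma mxnorm_sgperm_le : mxnorm W <= 1.
Proof. by apply: mxnorm_le => // v; rewrite l2norm_sgperm mul1r. Qed.

Lemma mxnorm_sgperm_tr : mxnorm W^T <= 1.
Proof.
apply: mxnorm_le => // v.
by rewrite -l2norm_sgperm mulmxA sgperm_mulV mul1mx mul1r.
Qed.

Lemma mxnorm_sgperm_conj M : mxnorm (W *m M *m W^T) <= mxnorm M.
Proof.
apply: le_trans (mxnormM _ _) _.
rewrite -[leRHS]mulr1; apply: ler_pM; rewrite ?mxnorm_ge0 ?mxnorm_sgperm_tr //.
apply: le_trans (mxnormM _ _) _.
by rewrite ler_piMl ?mxnorm_ge0 ?mxnorm_sgperm_le.
Qed.

End Injective.

Lemma sgperm_comm f g sf sg : (forall s, f (g s) = g (f s)) ->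
  (forall s, sf (g s) = sf s) -> (forall s, sg (f s) = sg s) ->
  sgperm_mx f sf *m sgperm_mx g sg = sgperm_mx g sg *m sgperm_mx f sf.
Proof.
move=> fg fS gS; apply: entryP => s s'; rewrite !entry_sgperm_mull !entry_mx_of.
by rewrite fg fS gS !mulrnAr mulrC.
Qed.

End MatrixEntries.

Section Twirl.
Variables (R : realType) (T : finType) (d : nat).
Local Notation signs := {ffun 'I_d.+1 -> bool}.
Local Notation cfg := {ffun T -> 'I_d.+1}.
Implicit Types (x y z : T) (s : cfg) (a c : 'I_d.+1) (eps : signs).
Implicit Types M N : 'M[R[i]]_#|{: cfg}|.

Definition upd s x a : cfg := [ffun z => if z == x then a else s z].

Lemma upd_eq s x a : upd s x a x = a.
Proof. by rewrite ffunE eqxx. Qed.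

Lemma upd_neq s x a z : z != x -> upd s x a z = s z.
Proof. by rewrite ffunE => /negbTE ->. Qed.

Lemma upd_upd s x a b : upd (upd s x a) x b = upd s x b.
Proof. by apply/ffunP => z; rewrite !ffunE; case: eqP. Qed.

Lemma updC s x y a b : x != y -> upd (upd s x a) y b = upd (upd s y b) x a.
Proof.
move=> xy; apply/ffunP => z; rewrite !ffunE.
by case: (eqVneq z y) => // ->; rewrite eq_sym (negbTE xy).
Qed.

(** The addition is that of ['I_d.+1], modulo d + 1, hence a cyclic shift of the basis at the site
    x; writing the dimension as a successor makes it available. *)
Definition shift_mx x c eps : 'M[R[i]]_#|{: cfg}| :=
  sgperm_mx R (fun s => upd s x (s x + c)) (fun s => eps (s x)).

Lemma shift_inj x c : injective (fun s => upd s x (s x + c)).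
Proof.
move=> s s' /ffunP ss'; apply/ffunP => z; have := ss' z; rewrite !ffunE.
by case: eqP => [-> /addIr|].
Qed.

Lemma shift_mxC x y c c' eps eps' : x != y ->
  shift_mx x c eps *m shift_mx y c' eps' = shift_mx y c' eps' *m shift_mx x c eps.
Proof.
move=> xy; have yx : y != x by rewrite eq_sym.
apply: sgperm_comm => s /=; rewrite ?(upd_neq _ _ xy) ?(upd_neq _ _ yx) //.
exact: updC.
Qed.

Lemma commutator_shift x y c c' eps eps' : x != y ->
  commutator (shift_mx x c eps) (shift_mx y c' eps') = 0.
Proof. by move=> xy; rewrite /commutator (shift_mxC c c' eps eps' xy) subrr. Qed.

(* The normalized partial trace over the site x, tensored with 1 at x. *)
Definition twirl x M : 'M[R[i]]_#|{: cfg}| :=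
  mx_of (fun s s' => d.+1%:R^-1 *
    \sum_a entry M (upd s x a) (upd s' x a) *+ (s x == s' x)).

Lemma entry_twirl x M s s' : entry (twirl x M) s s' =
  d.+1%:R^-1 * \sum_a entry M (upd s x a) (upd s' x a) *+ (s x == s' x).
Proof. exact: entry_mx_of. Qed.

(** Orthogonality of characters of the group of signs: for a != b, flipping the sign at a is a
    bijection that turns the sum into its opposite. *)
Lemma signr_sum a b :
  \sum_(eps : signs) (-1) ^+ eps a * (-1) ^+ eps b = (2 ^ d.+1)%:R *+ (a == b) :> R[i].
Proof.
case: (eqVneq a b) => [<-|ab].
  rewrite (eq_bigr (fun _ => 1)) => [|eps _]; last by rewrite -signr_addb addbb.
  by rewrite sumr_const card_ffun card_bool card_ord.
pose flip eps : signs := [ffun e => eps e (+) (e == a)].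
have flipK : involutive flip.
  by move=> eps; apply/ffunP => e; rewrite !ffunE -addbA addbb addbF.
set F := LHS; have : F = - F.
  rewrite {1}/F (reindex_inj (inv_inj flipK)) -sumrN; apply: eq_bigr => eps _.
  by rewrite !ffunE eqxx (eq_sym b) (negbTE ab) addbT addbF signrN mulNr.
by move/eqP; rewrite -subr_eq0 opprK -mulr2n mulrn_eq0 /= => /eqP ->.
Qed.

(** Conjugation multiplies an entry by eps (s x) and eps (s' x) as signs, so summing over [eps]
    leaves only s x = s' x, with weight 2^(d+1). The sum over c then runs through all common values
    at x. *)
Lemma twirl_average x M : twirl x M = ((d.+1 * 2 ^ d.+1)%N%:R)^-1 *:
  \sum_c \sum_(eps : signs) shift_mx x c eps *m M *m (shift_mx x c eps)^T.
Proof.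
apply: entryP => s s'; rewrite entry_twirl entryZ entry_sum.
have entry_conj c :
    entry (\sum_(eps : signs) shift_mx x c eps *m M *m (shift_mx x c eps)^T) s s' =
    (2 ^ d.+1)%:R * (entry M (upd s x (s x + c)) (upd s' x (s' x + c)) *+ (s x == s' x)).
  rewrite mulrnAr -mulrnAl -signr_sum entry_sum mulr_suml; apply: eq_bigr => eps _.
  by rewrite entry_sgperm_mulr_tr entry_sgperm_mull mulrA [X in X * _]mulrC.
rewrite (eq_bigr _ (fun c _ => entry_conj c)) -mulr_sumr mulrA natrM invfM.
rewrite divfK ?pnatr_eq0 ?expn_eq0 //; congr (_ * _).
rewrite (reindex_inj (addrI (s x))); apply: eq_bigr => c _.
by case: eqP => [->|//].
Qed.

Lemma sum_shift_const (V : nmodType) (v : V) :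
  \sum_(c : 'I_d.+1) \sum_(eps : signs) v = v *+ (d.+1 * 2 ^ d.+1).
Proof. by rewrite !sumr_const card_ffun card_bool card_ord -mulrnA mulnC. Qed.

(** Each conjugation satisfies M - W M W^T = [M, W] W^T, and W^T does not increase norms. Averaging
    keeps the constant [C]. *)
Lemma twirl_bound x M (C : R) :
  (forall c eps, mxnorm (commutator M (shift_mx x c eps)) <= C) ->
  mxnorm (M - twirl x M) <= C.
Proof.
move=> MC; have C0 : 0 <= C := le_trans (mxnorm_ge0 _) (MC 0 [ffun=> false]).
pose N := (d.+1 * 2 ^ d.+1)%N.
have N0 : N%:R != 0 :> R[i] by rewrite pnatr_eq0 muln_eq0 expn_eq0.
have -> : M - twirl x M = N%:R^-1 *: \sum_c \sum_(eps : signs)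
    commutator M (shift_mx x c eps) *m (shift_mx x c eps)^T.
  apply: (scalerI N0); rewrite twirl_average -/N scalerBr !scalerA mulfV // !scale1r.
  have -> : N%:R *: M = \sum_(c : 'I_d.+1) \sum_(eps : signs) M.
    by rewrite sum_shift_const scaler_nat.
  rewrite -sumrB; apply: eq_bigr => c _; rewrite -sumrB; apply: eq_bigr => eps _.
  by rewrite mulmxBl -[M *m _ *m _]mulmxA /shift_mx sgperm_mulV ?mulmx1 //; exact: shift_inj.
rewrite mxnormZ normcV normc_nat -ler_pdivlMl ?invr_gt0 ?ltr0n ?muln_gt0 ?expn_gt0 //.
rewrite invrK; apply: le_trans (mxnorm_sum _ _ _) _.
have -> : N%:R * C = \sum_(c : 'I_d.+1) \sum_(eps : signs) C.
  by rewrite sum_shift_const mulr_natl.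
apply: ler_sum => c _; apply: le_trans (mxnorm_sum _ _ _) _.
apply: ler_sum => eps _; apply: le_trans (mxnormM _ _) _.
rewrite -[leRHS]mulr1; apply: ler_pM; rewrite ?mxnorm_ge0 //.
by apply: mxnorm_sgperm_tr; exact: shift_inj.
Qed.

Lemma mxnorm_twirl x M : mxnorm (twirl x M) <= mxnorm M.
Proof.
rewrite twirl_average mxnormZ normcV normc_nat.
rewrite -ler_pdivlMl ?invr_gt0 ?ltr0n ?muln_gt0 ?expn_gt0 //.
rewrite invrK; apply: le_trans (mxnorm_sum _ _ _) _.
have -> : (d.+1 * 2 ^ d.+1)%:R * mxnorm M =
    \sum_(c : 'I_d.+1) \sum_(eps : signs) mxnorm M.
  by rewrite sum_shift_const mulr_natl.
apply: ler_sum => c _; apply: le_trans (mxnorm_sum _ _ _) _.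
by apply: ler_sum => eps _; apply: mxnorm_sgperm_conj; exact: shift_inj.
Qed.

Lemma twirl_is_zmod_morphism x : zmod_morphism (twirl x).
Proof.
move=> M N; apply: entryP => s s'; rewrite entryD entryN !entry_twirl.
rewrite -mulrBr -sumrB; congr (_ * _); apply: eq_bigr => a _.
by rewrite entryD entryN mulrnBl.
Qed.

HB.instance Definition _ x := GRing.isZmodMorphism.Build _ _ (twirl x)
  (twirl_is_zmod_morphism x).

(** With [twirl_shift_mul], this lets the partial trace at x pass through a commutator with an
    operator at y. *)
Lemma twirl_mul_shift x y c eps M : x != y ->
  twirl x (M *m shift_mx y c eps) = twirl x M *m shift_mx y c eps.
Proof.
move=> xy; rewrite !twirl_average -scalemxAl; congr (_ *: _).
rewrite mulmx_suml; apply: eq_bigr => c' _; rewrite mulmx_suml.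
apply: eq_bigr => eps' _; set U := shift_mx x c' eps'; set V := shift_mx y c eps.
have UI : injective (fun s => upd s x (s x + c')) by exact: shift_inj.
have UV : U *m V = V *m U by exact: shift_mxC.
(* Multiplying U V = V U by U^T on both sides gives V U^T = U^T V. *)
suff VU : V *m U^T = U^T *m V by rewrite -!mulmxA VU.
rewrite -[V *m U^T]mul1mx -(sgperm_mulVl R (fun s => eps' (s x)) UI) -/U.
rewrite -mulmxA [U *m _]mulmxA UV -[V *m U *m _]mulmxA.
by rewrite (sgperm_mulV R (fun s => eps' (s x)) UI) mulmx1.
Qed.

Lemma twirl_shift_mul x y c eps M : x != y ->
  twirl x (shift_mx y c eps *m M) = shift_mx y c eps *m twirl x M.
Proof.
move=> xy; rewrite !twirl_average -scalemxAr; congr (_ *: _).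
rewrite mulmx_sumr; apply: eq_bigr => c' _; rewrite mulmx_sumr.
apply: eq_bigr => eps' _.
by rewrite [shift_mx x _ _ *m (_ *m M)]mulmxA shift_mxC // !mulmxA.
Qed.

Lemma twirlC x y M : twirl x (twirl y M) = twirl y (twirl x M).
Proof.
have [->//|xy] := eqVneq x y; have yx : y != x by rewrite eq_sym.
apply: entryP => s s'; rewrite !entry_twirl.
congr (_ * _).
under eq_bigr do rewrite entry_twirl !(upd_neq _ _ yx) -mulrnAr -sumrMnl.
under [RHS]eq_bigr do rewrite entry_twirl !(upd_neq _ _ xy) -mulrnAr -sumrMnl.
rewrite -!mulr_sumr exchange_big; congr (_ * _).
apply: eq_bigr => b _; apply: eq_bigr => a _.
by rewrite !(updC _ _ _ xy) mulrnAC.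
Qed.

Lemma twirl_idem x M : twirl x (twirl x M) = twirl x M.
Proof.
apply: entryP => s s'; rewrite !entry_twirl; congr (_ * _).
rewrite (eq_bigr (fun=> d.+1%:R^-1 *
  \sum_a entry M (upd s x a) (upd s' x a) *+ (s x == s' x))) => [|a _].
  by rewrite sumr_const card_ord -[LHS]mulr_natl mulrA divff ?mul1r ?pnatr_eq0.
rewrite entry_twirl !upd_eq eqxx -mulrnAr -sumrMnl; congr (_ * _).
by apply: eq_bigr => b _; rewrite !upd_upd.
Qed.

Lemma twirl_herm x M : M \is hermsymmx -> twirl x M \is hermsymmx.
Proof.
move=> /is_hermitianmxP; rewrite expr0 scale1r => hM.
have hE s s' : entry M s s' = (entry M s' s)^*.
  by rewrite {1}hM /entry !mxE.
apply/is_hermitianmxP; rewrite expr0 scale1r; apply: entryP => s s'.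
rewrite [RHS](_ : _ = (entry (twirl x M) s' s)^*); last by rewrite /entry !mxE.
rewrite !entry_twirl rmorphM rmorph_sum fmorphV rmorph_nat; congr (_ * _).
by apply: eq_bigr => a _; rewrite rmorphMn [in LHS]hE eq_sym.
Qed.

End Twirl.

(** * Components of an operator *)

Lemma subrACA (V : zmodType) (a b c e : V) : a - b - (c - e) = a - c - (b - e).
Proof. by rewrite !opprB [e - c]addrC [e - b]addrC addrACA. Qed.

Section Components.
Variables (R : realType) (T : finType) (d : nat).
Local Notation cfg := {ffun T -> 'I_d.+1}.
Implicit Types (x y z : T) (s : cfg) (X Y : {set T}) (r : seq T).
Implicit Types M N : 'M[R[i]]_#|{: cfg}|.

Definition component1 X z M := if z \in X then M - twirl z M else twirl z M.

(* For r an enumeration of T, the part of M that is traceless at every site of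
   X and trivial at every other site. *)
Definition component r X M := foldr (component1 X) M r.

Lemma component1_is_zmod_morphism X z : zmod_morphism (component1 X z).
Proof.
move=> M N; rewrite /component1; case: ifP => _; last exact: raddfB.
by rewrite raddfB subrACA.
Qed.

HB.instance Definition _ X z := GRing.isZmodMorphism.Build _ _ (component1 X z)
  (component1_is_zmod_morphism X z).

Lemma component_is_zmod_morphism r X : zmod_morphism (component r X).
Proof. by elim: r => [|z r IH] M N //=; rewrite IH raddfB. Qed.

HB.instance Definition _ r X := GRing.isZmodMorphism.Build _ _ (component r X)
  (component_is_zmod_morphism r X).

Lemma component1_twirl X y z M :
  component1 X z (twirl y M) = twirl y (component1 X z M).
Proof. by rewrite /component1 twirlC; case: ifP; rewrite ?raddfB. Qed.

Lemma component1C X y z M :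
  component1 X z (component1 X y M) = component1 X y (component1 X z M).
Proof.
by rewrite {2 3}/component1; case: ifP; rewrite ?raddfB /= component1_twirl.
Qed.

Lemma component_twirl r X z M : component r X (twirl z M) = twirl z (component r X M).
Proof. by elim: r => //= y r ->; rewrite component1_twirl. Qed.

Lemma component_component1 r X z M :
  component r X (component1 X z M) = component1 X z (component r X M).
Proof. by elim: r => //= y r ->; rewrite component1C. Qed.

(** The factors commute, so the one at any chosen site can be made to act first, directly on [M]. *)
Lemma component_rem r X z M : z \in r ->
  component r X M = component (rem z r) X (component1 X z M).
Proof.
elim: r => //= y r IH; rewrite inE eq_sym; case: eqVneq => [-> _|_ /= zr].
  by rewrite component_component1.
by rewrite IH.
Qed.

Lemma eq_component r X Y M : {in r, X =i Y} -> component r X M = component r Y M.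
Proof.
elim: r => //= z r IH XY; rewrite IH => [|y yr].
  by rewrite /component1 XY ?mem_head.
by rewrite XY // inE yr orbT.
Qed.

Lemma big_powersetU1 (V : nmodType) z X (F : {set T} -> V) : z \notin X ->
  \sum_(Y in powerset (z |: X)) F Y = \sum_(Y in powerset X) (F Y + F (z |: Y)).
Proof.
move=> zX; rewrite big_split (bigID (fun Y : {set T} => z \in Y)) /= addrC.
congr (_ + _).
  apply: eq_bigl => Y; rewrite !inE; apply/andP/idP => [[YzX zY]|YX].
    apply/subsetP => y yY; have := subsetP YzX y yY; rewrite !inE.
    by case: eqP => // yz; rewrite yz (negbTE zY) in yY.
  split; first exact: subset_trans YX (subsetU1 _ _).
  by apply: contra zX; exact: (subsetP YX).
rewrite (reindex_onto (fun Y => z |: Y) (fun Y => Y :\ z)) => [|Y /andP[_ zY]]; last first.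
  exact: setD1K.
apply: eq_bigl => Y; rewrite !inE eqxx /= andbT.
apply/andP/idP => [[/subsetP YzX /eqP YE]|YX].
  apply/subsetP => y yY; have := YzX y; rewrite !inE yY orbT => /(_ isT).
  by case: eqP => // yz; move: yY; rewrite -YE yz !inE eqxx.
by rewrite setUS // setU1K //; apply: contra zX; exact: (subsetP YX).
Qed.

(** Expansion of the identity, written as the product over z of E_z + (1 - E_z), one summand for
    each choice of X. *)
Lemma sum_component r M : uniq r ->
  \sum_(X in powerset [set z in r]) component r X M = M.
Proof.
elim: r => [_|z r IH /= /andP[zr ur]].
  have -> : [set z in [::]] = set0 :> {set T} by apply/setP => z; rewrite !inE.
  by rewrite powerset0 big_set1.
rewrite set_cons big_powersetU1 ?inE // -[RHS](IH ur).
apply: eq_bigr => X; rewrite inE => /subsetP Xr.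
have zX : z \notin X by apply: contra zr => /Xr; rewrite inE.
rewrite (@eq_component r (z |: X) X) => [|y yr].
  by rewrite /component1 (negbTE zX) !inE eqxx subrKC.
by rewrite !inE; case: eqP => // yz; rewrite yz (negbTE zr) in yr.
Qed.

Lemma mxnorm_component r X M :
  mxnorm (component r X M) <= 2 ^+ count [in X] r * mxnorm M.
Proof.
elim: r => /= [|z r IH]; first by rewrite mul1r.
rewrite exprD -mulrA; apply: (@le_trans _ _ (2 ^+ (z \in X) * mxnorm (component r X M))).
  rewrite /component1; case: ifP => _ /=; last by rewrite mul1r mxnorm_twirl.
  rewrite expr1 mulr_natl mulr2n; apply: le_trans (mxnormB _ _) _.
  by rewrite lerD2l mxnorm_twirl.
by rewrite ler_wpM2l // exprn_ge0.
Qed.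

Lemma twirl_component r X z M : z \in r -> z \notin X ->
  twirl z (component r X M) = component r X M.
Proof.
move=> zr zX; rewrite -component_twirl !(component_rem _ _ zr).
by rewrite /component1 (negbTE zX) twirl_idem.
Qed.

Lemma component_eq0 r X z M : z \in r -> z \in X -> twirl z M = M ->
  component r X M = 0.
Proof.
move=> zr zX Mz; rewrite (component_rem _ _ zr) /component1 zX Mz subrr.
exact: raddf0.
Qed.

Lemma component_herm r X M : M \is hermsymmx -> component r X M \is hermsymmx.
Proof.
move=> hM; elim: r => [|z r IH]; [exact: hM | rewrite /= /component1].
case: ifP => _; last exact: twirl_herm.
apply/is_hermitianmxP; rewrite expr0 scale1r.
have /is_hermitianmxP := IH; have /is_hermitianmxP := twirl_herm z IH.
rewrite !expr0 !scale1r => h1 h2.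
by rewrite linearB /= map_mxB /= -h1 -h2.
Qed.

(** The factors at x and y are brought to act first, where [twirl_bound] applies once for each; the
    remaining factors cost at most 2 per site of X. *)
Lemma component_bound r X x y M (C : R) :
  uniq r -> x \in r -> y \in r -> x \in X -> y \in X -> x != y ->
  (forall c eps c' eps', mxnorm (commutator
     (commutator M (shift_mx R x c eps)) (shift_mx R y c' eps')) <= C) ->
  mxnorm (component r X M) <= 2 ^+ count [in X] r * C.
Proof.
move=> ur xr yr xX yX xy MC.
have yr' : y \in rem x r by rewrite mem_rem_uniq // !inE eq_sym xy.
rewrite (component_rem _ _ xr) (component_rem _ _ yr').
apply: le_trans (mxnorm_component _ _ _) _.
apply: ler_pM; rewrite ?exprn_ge0 ?mxnorm_ge0 //.
  (* The exponent is enlarged from the count over r without x and y to the count over r, giving up a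
     factor 4. *)
  rewrite ler_eXn2l ?ltr1n //.
  apply: leq_trans (leq_count_subseq _ (rem_subseq _ _)).
  exact: leq_count_subseq (rem_subseq _ _).
rewrite component1C /component1 xX yX; apply: twirl_bound => c eps.
set V := shift_mx R x c eps; set N := M - twirl y M.
(* V acts at x only, so 1 - E_y passes through the commutator with V. The second use of
   [twirl_bound], at y, then meets the double commutator. *)
have -> : commutator N V = commutator M V - twirl y (commutator M V).
  rewrite /commutator /N /V mulmxBl mulmxBr [twirl y (_ - _)]raddfB /=.
  rewrite twirl_mul_shift 1?eq_sym // twirl_shift_mul 1?eq_sym //.
  move: (shift_mx R x c eps) => W.
  by rewrite subrACA.
by apply: twirl_bound => c' eps'; exact: MC.
Qed.

Definition reset r s : cfg := [ffun z => if z \in r then 0 else s z].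

(** An operator trivial on r is diagonal there, with entries independent of the common values on r.
    These values may therefore be replaced by the reference value 0. *)
Lemma entry_reset r M : (forall z, z \in r -> twirl z M = M) -> forall s s',
  entry M s s' = entry M (reset r s) (reset r s') *+ [forall z in r, s z == s' z].
Proof.
elim: r => [_|z r IH Mr] s s'.
  rewrite (_ : [forall z in _, _]) //; last by apply/forall_inP.
  by congr (entry M _ _); apply/ffunP => z; rewrite ffunE.
have reset_cons t : reset (z :: r) t = upd (reset r t) z 0.
  by apply/ffunP => y; rewrite !ffunE inE; case: eqP.
have MzE t t' : entry M t t' = entry M (upd t z 0) (upd t' z 0) *+ (t z == t' z).
  (* The right-hand side does not mention a: all diagonal blocks at z agree, in particular with the
     one at 0. *)
  have e t1 t1' a : entry M (upd t1 z a) (upd t1' z a) =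
      d.+1%:R^-1 * \sum_b entry M (upd t1 z b) (upd t1' z b).
    rewrite -{1}(Mr z (mem_head _ _)) entry_twirl !upd_eq eqxx.
    by congr (_ * _); apply: eq_bigr => b _; rewrite !upd_upd.
  rewrite -{1}(Mr z (mem_head _ _)) entry_twirl sumrMnl mulrnAr.
  by rewrite -(e _ _ 0).
rewrite IH => [|y yr]; last by apply: Mr; rewrite inE yr orbT.
rewrite MzE !reset_cons -mulrnA mulnb; congr (_ *+ (nat_of_bool _)).
apply/andP/forall_inP => [[rz /forall_inP Hr] y|Hr].
  rewrite inE => /orP[/eqP ->|]; last exact: Hr.
  move: rz; rewrite !ffunE; case: ifP => // zr _; exact: Hr.
split; last by apply/forall_inP => y yr; apply: Hr; rewrite inE yr orbT.
by rewrite !ffunE; case: ifP => // _; apply: Hr; exact: mem_head.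
Qed.

End Components.

(** * Embedding and compression *)

Section Lattice.
Variables (R : realType) (D d : nat).
Implicit Types (X Y L : {fset 'rV[int]_D}).
Implicit Types (c : 'I_d.+1) (eps : {ffun 'I_d.+1 -> bool}).
Local Notation cfg X := {ffun X -> 'I_d.+1}.

Lemma hermsymmxP (n : nat) (M : 'M[R[i]]_n) :
  reflect (forall i j, M i j = (M j i)^*) (M \is hermsymmx).
Proof.
apply: (iffP (is_hermitianmxP _ _ _)); rewrite expr0 scale1r => hM.
  by move=> i j; rewrite {1}hM !mxE.
by apply/matrixP => i j; rewrite hM !mxE.
Qed.

Lemma herm_entry (S : finType) (M : 'M[R[i]]_#|S|) :
  (forall s s', entry M s s' = (entry M s' s)^*) -> M \is hermsymmx.
Proof.
move=> hM; apply/hermsymmxP => i j; have := hM (enum_val i) (enum_val j).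
by rewrite /entry !enum_valK.
Qed.

Definition restrict_cfg Y X (sYX : Y `<=` X) (s : cfg X) : cfg Y :=
  [ffun y => s (fincl sYX y)].

Lemma entry_embed Y X (sYX : Y `<=` X) (A : op R d.+1 Y) (s s' : cfg X) :
  entry (embed sYX A) s s' =
  entry A (restrict_cfg sYX s) (restrict_cfg sYX s')
    *+ [forall x : X, (val x \notin Y) ==> (s x == s' x)].
Proof. by rewrite /entry mxE /= !enum_rankK; case: ifP. Qed.

Lemma embed0 Y X (sYX : Y `<=` X) : embed sYX (0 : op R d.+1 Y) = 0.
Proof. by apply: entryP => s s'; rewrite entry_embed !entry0 mul0rn. Qed.

Lemma embed_herm Y X (sYX : Y `<=` X) (A : op R d.+1 Y) :
  A \is hermsymmx -> embed sYX A \is hermsymmx.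
Proof.
move=> /hermsymmxP hA; apply: herm_entry => s s'; rewrite !entry_embed rmorphMn.
rewrite /entry [in LHS]hA; congr (_ *+ nat_of_bool _).
by apply: eq_forallb => x; rewrite eq_sym.
Qed.

Lemma twirl_embed Y X (sYX : Y `<=` X) (A : op R d.+1 Y) (x : X) :
  val x \notin Y -> twirl x (embed sYX A) = embed sYX A.
Proof.
move=> xY; apply: entryP => s s'; rewrite entry_twirl.
case: (eqVneq (s x) (s' x)) => [sx|sx]; last first.
  rewrite big1 ?mulr0 // entry_embed; case: forallP => // /(_ x).
  by rewrite xY /= (negbTE sx).
rewrite (eq_bigr (fun=> entry (embed sYX A) s s')) => [|a _].
  by rewrite sumr_const card_ord -[X in _ * X]mulr_natl mulrA mulVf ?mul1r ?pnatr_eq0.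
have restrict_upd t : restrict_cfg sYX (upd t x a) = restrict_cfg sYX t.
  apply/ffunP => y; rewrite !ffunE; case: eqP => // yx.
  by move: xY; rewrite -yx (valP y).
rewrite mulr1n !entry_embed !restrict_upd; congr (_ *+ nat_of_bool _).
apply: eq_forallb => z; rewrite !ffunE; case: (z =P x) => // zx.
by rewrite zx sx !eqxx.
Qed.

(** This identifies the shifts on the whole region with embedded single-site operators, the only
    ones allowed in [lieb_robinson]. *)
Lemma embed_shift X (x : X) c eps :
  embed (site_sub x) (shift_mx R [` fset11 (val x)] c eps) = shift_mx R x c eps.
Proof.
apply: entryP => s s'; rewrite entry_embed !entry_mx_of.
set x0 := [` fset11 (val x)]; have x0E : fincl (site_sub x) x0 = x by apply: val_inj.
have -> : restrict_cfg (site_sub x) s x0 = s x by rewrite ffunE x0E.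
rewrite -mulrnA mulnb; congr (_ *+ nat_of_bool _).
have eq_x0 (y : [fset val x]) : y = x0.
  by apply: val_inj; apply/eqP; rewrite -in_fset1; exact: valP.
apply/andP/eqP => [[/eqP /ffunP /(_ x0) sx0 /forallP ss']|->].
  apply/ffunP => z; rewrite ffunE; case: eqP => [->|/eqP zx].
    by move: sx0; rewrite !ffunE x0E eqxx.
  apply/esym/eqP; apply: (implyP (ss' z)).
  by rewrite in_fset1 (inj_eq val_inj).
split.
  by apply/eqP/ffunP => y; rewrite (eq_x0 y) !ffunE x0E !eqxx.
apply/forallP => z; apply/implyP; rewrite in_fset1 (inj_eq val_inj) => zx.
by rewrite upd_neq.
Qed.

Lemma card_cfg_gt0 X : (0 < #|{: cfg X}|)%N.
Proof. by apply/card_gt0P; exists [ffun=> 0]. Qed.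

(** The crude factor is harmless: the estimate serves only to show that the ratios in
    [lieb_robinson] are bounded above. *)
Lemma mxnorm_embed Y X (sYX : Y `<=` X) (A : op R d.+1 Y) :
  mxnorm (embed sYX A) <= (#|{: cfg X}| * #|{: cfg X}|)%:R * mxnorm A.
Proof.
apply: le_trans (mxnorm_le_sum _) _.
apply: (@le_trans _ _ (\sum_(i < #|{: cfg X}|) \sum_(j < #|{: cfg X}|) mxnorm A)).
  apply: ler_sum => i _; apply: ler_sum => j _; rewrite mxE /=.
  by case: ifP => _; rewrite ?normc0 ?mxnorm_ge0 ?normc_le_mxnorm.
by rewrite !sumr_const !card_ord -mulrnA mulr_natl.
Qed.

Lemma mxnorm_shift X (x : X) c eps : mxnorm (shift_mx R x c eps) = 1.
Proof. by apply: mxnorm_sgperm (card_cfg_gt0 X); exact: shift_inj. Qed.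

Lemma shift_mx_neq0 X (x : X) c eps : shift_mx R x c eps != 0.
Proof.
by apply/eqP => s0; have /eqP := mxnorm_shift x c eps; rewrite s0 mxnorm0 eq_sym oner_eq0.
Qed.

Lemma lieb_robinson_shift L (P : potential_on R d.+1 L) (x y : L) t c eps c' eps' :
  mxnorm (commutator (evolution (hamiltonian P) t (shift_mx R x c eps))
                     (shift_mx R y c' eps')) <= lieb_robinson P x y t.
Proof.
have regroup (a b u v n : R) :
    a * n * b * n *+ 2 * (u * v) = (a * (n * u) * b) * (n * v) *+ 2 by ring.
rewrite -(embed_shift x c eps) -(embed_shift y c' eps') /lieb_robinson; set H := hamiltonian P.
pose A0 := shift_mx R [` fset11 (val x)] c eps.
pose B0 := shift_mx R [` fset11 (val y)] c' eps'.
apply: ub_le_sup; last first.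
  exists A0, B0; split; [exact: shift_mx_neq0 | exact: shift_mx_neq0 |].
  by rewrite -!mxnormE !mxnorm_shift mulr1 divr1.
rewrite /evolution; set e1 := expmx _; set e2 := expmx _.
pose N : R := (#|{: cfg L}| * #|{: cfg L}|)%:R.
(* Any bound independent of A and B will do, so the two exponentials enter through their norms,
   without appeal to unitarity. *)
exists (mxnorm e1 * N * mxnorm e2 * N *+ 2) => _ [A [B [_ _ ->]]].
rewrite -!mxnormE; have [->|AB0] := eqVneq (mxnorm A * mxnorm B) 0.
  by rewrite invr0 mulr0 mulrn_wge0 // !mulr_ge0 ?mxnorm_ge0 ?ler0n.
have AB : 0 < mxnorm A * mxnorm B by rewrite lt0r AB0 mulr_ge0 ?mxnorm_ge0.
rewrite ler_pdivrMr //; apply: le_trans (mxnorm_commutator _ _) _.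
rewrite regroup lerMn2r /=; apply: ler_pM; rewrite ?mxnorm_ge0 ?mxnorm_embed //.
apply: le_trans (mxnormM _ _) _; apply: ler_wpM2r; first exact: mxnorm_ge0.
apply: le_trans (mxnormM _ _) _; apply: ler_wpM2l; first exact: mxnorm_ge0.
exact: mxnorm_embed.
Qed.

Definition extend_cfg Y X (u : cfg Y) : cfg X :=
  [ffun z => oapp u 0 (insub (val z))].

Lemma extend_cfg_inj Y X : Y `<=` X -> injective (@extend_cfg Y X).
Proof.
move=> sYX u u' /ffunP uu'; apply/ffunP => y; have := uu' (fincl sYX y).
by rewrite !ffunE /= valK.
Qed.

(** The block of [N] at the configuration 0 outside Y. For an operator A (x) 1 it returns A, as a
    normalized partial trace would, and being a submatrix it does not increase norms. *)
Definition compress Y X (N : op R d.+1 X) : op R d.+1 Y :=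
  mx_of (fun u u' => entry N (extend_cfg X u) (extend_cfg X u')).

Lemma compress_herm Y X (N : op R d.+1 X) :
  N \is hermsymmx -> compress Y N \is hermsymmx.
Proof.
by move=> /hermsymmxP hN; apply/hermsymmxP => i j; rewrite !mxE; exact: hN.
Qed.

Lemma mxnorm_compress Y X (N : op R d.+1 X) : Y `<=` X ->
  mxnorm (compress Y N) <= mxnorm N.
Proof.
move=> sYX; pose f (a : 'I_#|{: cfg Y}|) := enum_rank (extend_cfg X (enum_val a)).
have fI : injective f.
  by move=> a b /enum_rank_inj /(extend_cfg_inj sYX) /enum_val_inj.
have -> : compress Y N = mxsub f f N by apply/matrixP => a b; rewrite !mxE.
exact: mxnorm_mxsub_le.
Qed.

(** Restricting a configuration to Y and extending it by 0 is [reset] off Y, so [entry_reset]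
    recovers every entry of [N] from the block kept by [compress]. *)
Lemma compressK Y X (sYX : Y `<=` X) (N : op R d.+1 X) :
  (forall z : X, val z \notin Y -> twirl z N = N) -> embed sYX (compress Y N) = N.
Proof.
move=> NY; pose r := [seq z <- enum {: X} | val z \notin Y].
have rE z : (z \in r) = (val z \notin Y) by rewrite mem_filter mem_enum andbT.
apply: entryP => s s'; rewrite entry_embed entry_mx_of (@entry_reset _ _ _ r); last first.
  by move=> z; rewrite rE; exact: NY.
have extendK t : extend_cfg X (restrict_cfg sYX t) = reset r t.
  apply/ffunP => z; rewrite !ffunE rE; case: insubP => [y yY yz|/negbTE -> //].
  by rewrite yY /= ffunE; congr (t _); apply: val_inj; rewrite /= yz.
rewrite [RHS](@entry_reset _ _ _ r); last by move=> z; rewrite rE; exact: NY.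
rewrite !extendK.
have reset_idem t : reset r (reset r t) = reset r t.
  by apply/ffunP => z; rewrite !ffunE; case: (z \in r).
rewrite !reset_idem (_ : [forall z in r, _] = true) ?mulr1n; last first.
  by apply/forall_inP => z zr; rewrite !ffunE zr.
by congr (_ *+ nat_of_bool _); apply: eq_forallb => z; rewrite rE.
Qed.

End Lattice.

(** * The canonical potential *)

Section GraphDistance.
Variable D : nat.
Implicit Types (x y : 'rV[int]_D) (X : {fset 'rV[int]_D}).

Lemma graph_distxx x : graph_dist x x = 0%N.
Proof.
rewrite /graph_dist; case: ex_minnP => n _ /(_ 0%N) n0; apply/eqP.
by rewrite -leqn0 n0 //; apply/asboolP; exists [::].
Qed.

Lemma graph_dist_eq0 x y : graph_dist x y = 0%N -> x = y.
Proof.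
rewrite /graph_dist; case: ex_minnP => n /asboolP wn _ n0; subst n.
by case: wn => p [_ <- /size0nil ->].
Qed.

Lemma diam_attained X : (2 <= #|` X|)%N ->
  exists x y : X, x != y /\ graph_dist (val x) (val y) = diam X.
Proof.
rewrite cardfE => X2; have X0 := ltnW X2.
have [x dx] := bigop.eq_bigmax (fun x : X => \max_(y : X) graph_dist (val x) (val y))%N X0.
have [y dy] := bigop.eq_bigmax (fun y : X => graph_dist (val x) (val y)) X0.
have dxy : graph_dist (val x) (val y) = diam X by rewrite /diam dx dy.
(* The maximizing pair may coincide only if the diameter is 0, and then any two distinct points of X
   attain it as well. *)
have [xy|xy] := eqVneq x y; last by exists x, y.
have diam0 : diam X = 0%N by rewrite -dxy xy graph_distxx.
have /card_gt1P[x1 [y1 [_ _ xy1]]] := X2.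
exists x1, y1; split=> //; apply/eqP; rewrite eqn_leq {2}diam0 leq0n andbT /diam.
by rewrite (leq_trans _ (bigop.leq_bigmax x1)) // (leq_trans _ (bigop.leq_bigmax y1)).
Qed.

End GraphDistance.

Section CanonicalPotential.
Variables (R : realType) (D d : nat) (L : {fset 'rV[int]_D}).
Variable P : potential_on R d.+1 L.
Local Notation H := (hamiltonian P).

Lemma pot_on_herm (X : fpowerset L) : P X \is hermsymmx.
Proof. by case: P. Qed.

Lemma hamiltonian_herm : H \is hermsymmx.
Proof.
apply/hermsymmxP => i j; rewrite !summxE rmorph_sum; apply: eq_bigr => X _.
by have /hermsymmxP := embed_herm (fpowerset_sub X) (pot_on_herm X); apply.
Qed.

Definition canonical_component (X : {fset 'rV[int]_D}) : op R d.+1 L :=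
  component (enum {: L}) (fsub L X) H.

Lemma canonical_herm (X : fpowerset L) :
  compress (val X) (canonical_component (val X)) \is hermsymmx.
Proof. by apply: compress_herm; apply: component_herm; exact: hamiltonian_herm. Qed.

Definition canonical_potential : potential_on R d.+1 L := PotentialOn canonical_herm.

Lemma embed_canonical (X : fpowerset L) :
  embed (fpowerset_sub X) (canonical_potential X) = canonical_component (val X).
Proof.
apply: compressK => z zX; apply: twirl_component; first exact: mem_enum.
by rewrite in_fsub.
Qed.

Lemma fsub_bij : bijective (fun X : fpowerset L => fsub L (val X)).
Proof.
have sub (A : {set L}) : [fsetval y in A] \in fpowerset L.
  by rewrite fpowersetE; exact: fset_sub_val.
exists (fun A => [` sub A]) => [X|A].
  by apply: val_inj; rewrite /= fsubK // fpowerset_sub.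
by apply/setP => z; rewrite in_fsub /= in_fset_val valK.
Qed.

Lemma hamiltonian_canonical : hamiltonian canonical_potential = H.
Proof.
rewrite /hamiltonian (eq_bigr (fun X => canonical_component (val X))); last first.
  by move=> X _; exact: embed_canonical.
rewrite -[RHS](sum_component H (enum_uniq {: L})).
rewrite [RHS](reindex (fun X : fpowerset L => fsub L (val X))) /=; last first.
  exact: onW_bij fsub_bij.
apply: eq_bigl => X; rewrite inE; apply/esym/fintype.subsetP => z _.
by rewrite inE mem_enum.
Qed.

Lemma canonical_kbody k : kbody_on k P -> kbody_on k canonical_potential.
Proof.
move=> kP X kX; suff c0 : canonical_component (val X) = 0.
  by apply: entryP => u u'; rewrite entry_mx_of c0 !entry0.
rewrite /canonical_component raddf_sum big1 // => Y _.
have [kY|kY] := ltnP k #|` val Y|; first by rewrite (kP Y kY) embed0; exact: raddf0.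
(* As |Y| <= k < |X|, some site of X lies outside Y; there the term is trivial and 1 - E_x
   annihilates it. *)
have /fsubsetPn[x xX xY] : ~~ (val X `<=` val Y).
  by apply: contraTN kX => /fsubset_leq_card XY; rewrite -leqNgt (leq_trans XY).
have xL : x \in L := fsubsetP (fpowerset_sub X) x xX.
apply: (@component_eq0 _ _ _ _ _ [` xL]); rewrite ?mem_enum ?in_fsub //.
exact: twirl_embed.
Qed.

Lemma mxnorm_canonical (X : fpowerset L) (x y : L) (C : R) :
  val x \in val X -> val y \in val X -> x != y ->
  (forall c eps c' eps', mxnorm (commutator
     (commutator H (shift_mx R x c eps)) (shift_mx R y c' eps')) <= C) ->
  mxnorm (canonical_potential X) <= 2 ^+ #|` val X| * C.
Proof.
move=> xX yX xy HC.
apply: le_trans (mxnorm_compress _ (fpowerset_sub X)) _.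
rewrite -(card_fsub (fpowerset_sub X)) -sum1_card.
have <- : count [in fsub L (val X)] (enum {: L}) = \sum_(i in fsub L (val X)) 1%N.
  by rewrite -sum1_count big_enum_cond.
apply: component_bound HC; rewrite ?mem_enum ?in_fsub //; exact: enum_uniq.
Qed.

End CanonicalPotential.

Theorem theorem2 (R : realType) (k : nat) :
  exists m_k : R,
  forall (D d : nat) (d_gt0 : (0 < d)%N) (Phi : potential R D d)
         (Phi_kbody : kbody k Phi) (h : R -> nat -> R)
         (h0 : forall r : nat, (0 < r)%N -> h 0 r = 0)
         (h_diff : forall r : nat, differentiable_from0 (h ^~ r))
         (lieb_robinson_le : forall (L : {fset 'rV[int]_D}) (x y : L) (t : R),
            x != y -> 0 <= t ->
            lieb_robinson (restrict Phi L) x y t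
              <= h t (graph_dist (val x) (val y))),
  forall L : {fset 'rV[int]_D},
  exists hPhi : potential_on R d L,
    [/\ kbody_on k hPhi,
        same_evolution hPhi (restrict Phi L) &
        forall X : fpowerset L, (2 <= #|` val X|)%N ->
          opnorm (hPhi X) <= m_k * right_derive (h ^~ (diam (val X))) 0].
Proof.
(* The estimate gives 2^|X|, which is at most 2^k for |X| <= k; larger X carry no interaction. *)
exists (2 ^+ k) => D [//|d] _ Phi kPhi h h0 h_diff lr_le L.
set P := restrict Phi L.
have kP : kbody_on k P by move=> X; exact: kPhi.
have kQ := canonical_kbody kP.
exists (canonical_potential P); split=> [//|t A|X X2].
  by rewrite hamiltonian_canonical.
have [x0 [y0 [xy0 dxy]]] := diam_attained X2.
pose x := fincl (fpowerset_sub X) x0; pose y := fincl (fpowerset_sub X) y0.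
have xy : x != y by rewrite (inj_eq (@fincl_inj _ _ _ _)).
set C := right_derive _ 0.
have HC c eps c' eps' : mxnorm (commutator
    (commutator (hamiltonian P) (shift_mx R x c eps)) (shift_mx R y c' eps')) <= C.
  apply: commutator_right_derive_le => [|||t t0].
  - exact: commutator_shift.
  - apply: h0; rewrite -dxy lt0n; apply: contra_neq xy0 => /graph_dist_eq0.
    exact: val_inj.
  - exact: (h_diff _).2.
  - by rewrite -dxy; apply: le_trans (lr_le L x y t xy t0); exact: lieb_robinson_shift.
(* The derivative of h is nonnegative because it bounds a norm. This is used both for |X| > k and to
   enlarge 2^|X| to 2^k. *)
have C0 : 0 <= C := le_trans (mxnorm_ge0 _) (HC 0 [ffun=> false] 0 [ffun=> false]).
rewrite -mxnormE; have [kX|kX] := ltnP k #|` val X|.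
  by rewrite kQ // mxnorm0 mulr_ge0 ?exprn_ge0.
apply: le_trans (@mxnorm_canonical _ _ _ _ P X x y C (valP x0) (valP y0) xy HC) _.
by rewrite ler_wpM2r // ler_eXn2l ?ltr1n.
Qed.
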